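(* Let $F_{\mathbb Z}$ be a skew-periodic interval map without reflective boundary, with base map $F_0$ and step length function $\psi$ as in the context, and let $g:\mathfrak R_0\to\mathbb R$ be Hölder continuous. Then $$\mathcal P(g,\mathbb Z)=\inf_{q\in\mathbb R}\mathcal P(g+q\psi).$$
   Context: Conventions: $\mathbb N=\{0,1,2,\dots\}$. Pressures take values in $[-\infty,+\infty]$. Base map. $I\subset\mathbb N$ with $\mathrm{card}(I)\ge 2$ (finite or countably infinite), $(J_i)_{i\in I}$ are non-empty pairwise disjoint open subintervals of $(0,1)$, $\Delta_0=\bigcup_{i\in I}J_i$, and $F_0:\Delta_0\to(0,1)$ satisfies: $F_0(J_i)=(0,1)$ for every $i$; each $F_0|_{J_i}$ has a $C^2$-extension to a neighbourhood of $\overline{J_i}$; $\inf_{\Delta_0}|F_0'|>1$; $\sup_{\Delta_0}|F_0''|/(F_0')^2<\infty$. Step length function. $\psi:\Delta_0\to\mathbb Z$ is constant on each $J_i$, with $\inf\psi=-1<0<\sup\psi\le\infty$. Extension. $F_{\mathbb Z}:\Delta_0+\mathbb Z\to\mathbb R$, $F_{\mathbb Z}(x)=F_0(x-\lfloor x\rfloor)+\psi(x-\lfloor x\rfloor)+\lfloor x\rfloor$. For a map $f$ with domain $\Delta\subset\mathbb R$: $\mathfrak R(f)=\bigcap_{n\ge0}f^{-n}(\Delta)$ and $\mathrm{Per}_n(f)=\{x\in\mathfrak R(f):f^n(x)=x\}$. It is assumed that $F_{\mathbb Z}$ is topologically transitive on $\mathfrak R(F_{\mathbb Z})$ (for all non-empty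 relatively open $U,V$ there is $n\in\mathbb N$ with $F_{\mathbb Z}^n(U)\cap V\ne\emptyset$). Write $\mathfrak R_0=\mathfrak R(F_0)$; then $\mathfrak R(F_{\mathbb Z})=\mathfrak R_0+\mathbb Z$. Pressures. A function $g:\mathfrak R_0\to\mathbb R$ is called Hölder continuous if its restrictions to $\mathfrak R_0\cap J_i$ are Hölder continuous with exponent and constant independent of $i$. For such $g$ put $\mathcal P(g)=\limsup_{n}\frac1n\log\sum_{x\in\mathrm{Per}_n(F_0)\cap J_i}\exp\big(\sum_{k=0}^{n-1}g(F_0^k(x))\big)$ and $\mathcal P(g,\mathbb Z)=\limsup_{n}\frac1n\log\sum_{x\in\mathrm{Per}_n(F_{\mathbb Z})\cap (J_i+h)}\exp\big(\sum_{k=0}^{n-1}g_{\mathbb Z}(F_{\mathbb Z}^k(x))\big)$, where $g_{\mathbb Z}(x)=g(x-\lfloor x\rfloor)$; these do not depend on $i\in I$, $h\in\mathbb Z$. *)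

(* Defs.v *)
From HB Require Import structures.
From mathcomp Require Import all_boot all_order all_algebra.
From mathcomp Require Import all_classical all_reals all_analysis.

Set Implicit Arguments.
Unset Strict Implicit.
Unset Printing Implicit Defensive.

Import Order.TTheory GRing.Theory Num.Theory.
Import numFieldNormedType.Exports.

Local Open Scope ring_scope.
Local Open Scope classical_set_scope.

(* A partial map on the line is a total function f : R -> R together with its
   domain D; the values of f outside D are never used. *)

Section PartialMaps.
Context {R : realType}.
Implicit Types (f g : R -> R) (D A U : set R).

(* If all iterates of x stay in D, the iterates of the total function f are
   those of the partial map, so this is the intersection of the f^{-n}(D). *)
Definition repeller f D : set R := \bigcap_(n in [set: nat]) (iter n f @^-1` D).

Definition periodic_points f D (n : nat) : set R :=
  [set x | repeller f D x /\ iter n f x = x].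

Definition topologically_transitive f D : Prop :=
  forall U V : set R, open U -> open V ->
    repeller f D `&` U !=set0 -> repeller f D `&` V !=set0 ->
    exists n : nat,
      (iter n f @` (repeller f D `&` U)) `&` (repeller f D `&` V) !=set0.

Definition birkhoff_sum f g (n : nat) (x : R) : R :=
  \sum_(k < n) g (iter k f x).

(* The term n = 0 is irrelevant for the upper limit. *)
Definition pressure f D A g : \bar R :=
  limn_esup (fun n : nat =>
    ((n%:R^-1)%:E *
     lne (\esum_(x in periodic_points f D n `&` A)
            (expR (birkhoff_sum f g n x))%:E))%E).

Definition C2_on U f : Prop :=
  open U /\
  forall x, U x -> [/\ derivable f x 1, derivable f^`() x 1
                     & {for x, continuous f^`(2)}].

End PartialMaps.

Section SkewPeriodic.
Context {R : realType}.
Variables (I : set nat) (J : nat -> set R).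

Definition base_domain : set R := \bigcup_(i in I) J i.

Record base_map (F0 : R -> R) : Prop := BaseMap {
  base_index_card : exists i j, [/\ I i, I j & i <> j] ;
  base_cell : forall i, I i ->
    [/\ J i !=set0, open (J i), is_interval (J i) & J i `<=` `]0, 1[] ;
  base_disjoint : trivIset I J ;
  base_full_branch : forall i, I i -> F0 @` J i = `]0, 1[ ;
  base_C2 : forall i, I i -> exists (U : set R) (G : R -> R),
    [/\ closure (J i) `<=` U, C2_on U G & {in J i, F0 =1 G}] ;
  base_expanding :
    (1%:E < ereal_inf [set `|(F0^`())%classic x|%:E | x in base_domain])%E ;
  base_adler :
    (ereal_sup [set (`|(F0^`(2))%classic x| / ((F0^`())%classic x) ^+ 2)%:E
                  | x in base_domain]
       < +oo)%E }.

Record step_length (psi : R -> int) : Prop := StepLength {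
  step_constant : forall i, I i ->
    forall x y, J i x -> J i y -> psi x = psi y ;
  step_inf :
    ereal_inf [set ((psi x)%:~R : R)%:E | x in base_domain] = (-1)%:E ;
  step_sup :
    (0%:E < ereal_sup [set ((psi x)%:~R : R)%:E | x in base_domain])%E }.

Definition frac_part (x : R) : R := x - (Num.floor x)%:~R.

Definition extension (F0 : R -> R) (psi : R -> int) (x : R) : R :=
  F0 (frac_part x) + (psi (frac_part x))%:~R + (Num.floor x)%:~R.

Definition extension_domain : set R :=
  [set x + h%:~R | x in base_domain & h in [set: int]].

Definition holder (F0 g : R -> R) : Prop :=
  exists alpha C : R, 0 < alpha <= 1 /\
    forall i, I i -> forall x y,
      (repeller F0 base_domain `&` J i) x ->
      (repeller F0 base_domain `&` J i) y ->
      `|g x - g y| <= C * `|x - y| `^ alpha.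

Definition base_pressure (F0 : R -> R) (i : nat) (g : R -> R) : \bar R :=
  pressure F0 base_domain (J i) g.

Definition extension_pressure (F0 : R -> R) (psi : R -> int) (i : nat)
    (h : int) (g : R -> R) : \bar R :=
  pressure (extension F0 psi) extension_domain
    [set x + h%:~R | x in J i] (g \o frac_part).

End SkewPeriodic.

(* Main.v *)
(* The n-periodic points of the extension in a cell are the n-periodic points of
   F0 along which psi sums to 0, so P(g, Z) is the growth rate of a partition
   function restricted to level 0. Since adding q * psi to g changes nothing on
   that level, P(g, Z) <= P(g + q psi) for every q.

   Conversely let c > P(g, Z). Code by words over I; bounded distortion makes
   the weight exp(S_n g) of a word supermultiplicative up to a constant. Write
   B_n(k) for the renormalised total weight of the words of length n on which
   psi sums to k. Then B_(n+m)(k+l) >= B_n(k) B_m(l), and B_n(0) <= exp(c n).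
   Mixing words with positive and negative psi-sums shows that some q satisfies
   B_n(k) exp(q k) <= exp(c n) for all n and k. The m-th power of a finite family
   of words of length n takes only O(m) psi-values, so its total weight for
   g + q psi is O(m) exp(c n m); taking m-th roots removes the factor O(m), and
   P(g + q psi) <= c follows.

   Words need not be realised by periodic points, because the fixed point of an
   inverse branch may be 0 or 1. A word is realised as soon as it contains a
   block whose cylinder is relatively compact in (0, 1); prefixing words by such a
   block with psi-sum 0 costs only a constant factor. *)

Require Import Defs.
From HB Require Import structures.
From mathcomp Require Import all_boot all_order all_algebra.
From mathcomp Require Import all_classical all_reals all_analysis.
From mathcomp Require Import ring lra zify.

Set Implicit Arguments.
Unset Strict Implicit.
Unset Printing Implicit Defensive.

Import Order.TTheory GRing.Theory Num.Theory.
Import numFieldNormedType.Exports.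

Local Open Scope classical_set_scope.
Local Open Scope ring_scope.

(** * Exponential growth rates and the separating slope *)

Section Growth.
Context {R : realType}.
Implicit Types b c d : R.

Lemma bernoulli_ineq (r : R) (n : nat) : 0 <= r -> 1 + n%:R * r <= (1 + r) ^+ n.
Proof.
move=> r0; elim: n => [|n IH]; first by rewrite mul0r addr0 expr0.
rewrite exprS; apply: (@le_trans _ _ ((1 + r) * (1 + n%:R * r))); last first.
  by rewrite ler_wpM2l// addr_ge0.
rewrite -natr1; have : 0 <= n%:R * r * r by rewrite !mulr_ge0.
by move=> ?; lra.
Qed.

(** A linear factor loses against a ratio [b / d = 1 + r > 1]: Bernoulli for the exponent [k],
    squared, makes the power at exponent [k * 2] at least quadratic in [k]. *)
Lemma le_of_expr_growth b d A (m0 : nat) : 0 < d ->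
  (forall m, (m0 <= m)%N -> b ^+ m <= A * m%:R * d ^+ m) -> b <= d.
Proof.
move=> d0 bA; rewrite leNgt; apply/negP => db.
pose r := b / d - 1.
have r0 : 0 < r by rewrite subr_gt0 ltr_pdivlMr// mul1r.
have rA m : (m0 <= m)%N -> (1 + r) ^+ m <= A * m%:R.
  by move=> /bA; rewrite /r addrCA subrr addr0 expr_div_n ler_pdivrMr// exprn_gt0.
(* With [k r^2 > 2 |A|], the square [(1 + k r)^2] exceeds [2 k A]. *)
pose k := (maxn m0 (Num.trunc (2 * `|A| / r ^+ 2))).+1.
have kA : 2 * `|A| < k%:R * r ^+ 2.
  rewrite -ltr_pdivrMr ?exprn_gt0//; apply: lt_le_trans (truncnS_gt _) _.
  by rewrite ler_nat ltnS leq_maxr.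
have /rA : (m0 <= k * 2)%N.
  by rewrite muln2 -addnn (leq_trans _ (leq_addr _ _))// leqW// leq_maxl.
rewrite exprM natrM => krA.
have : (1 + k%:R * r) ^+ 2 <= ((1 + r) ^+ k) ^+ 2.
  have := bernoulli_ineq k (ltW r0).
  have : 0 <= k%:R * r by rewrite mulr_ge0// ltW.
  by move=> ? ?; rewrite lerXn2r// nnegrE; lra.
move=> /le_trans /(_ krA).
have k0 : 0 < k%:R :> R by rewrite ltr0n.
have AA := ler_norm A.
have h1 : k%:R * A <= k%:R * `|A| by rewrite ler_pM2l.
have h2 : k%:R * (2 * `|A|) < k%:R * (k%:R * r ^+ 2) by rewrite ltr_pM2l.
have h3 : 0 <= k%:R * r by rewrite mulr_ge0// ltW.
have -> : (1 + k%:R * r) ^+ 2 = 1 + 2 * (k%:R * r) + k%:R * (k%:R * r ^+ 2) by ring.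
by move=> h4; lra.
Qed.

(* The slope [q] separates the lower bounds forced by the triples with [k < 0]
   from the upper bounds forced by those with [k > 0]: combining [l] copies of a
   triple at height [k] with [k] copies of one at height [-l] lands at height 0. *)
Lemma separating_slope (T : nat -> int -> R -> Prop) c :
  (forall n k t m l u, T n k t -> T m l u -> T (n + m)%N (k + l) (t + u)) ->
  (forall n t, T n 0 t -> t <= c * n%:R) ->
  (exists n k t, T n k t /\ 0 < k) ->
  (exists n k t, T n k t /\ k < 0) ->
  exists q : R, forall n k t, T n k t -> t + q * k%:~R <= c * n%:R.
Proof.
move=> TD T0 [np [kp [tp [Tp kp0]]]] [nn [kn [tn [Tn kn0]]]].
have TM n k t a : T n k t -> T (n * a.+1)%N (k *+ a.+1) (t *+ a.+1).
  move=> Tnkt; elim: a => [|a IH]; first by rewrite muln1 !mulr1n.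
  by rewrite mulnS !(mulrS _ a.+1); exact: TD.
have key n (k : nat) t m (l : nat) u : T n k.+1%:Z t -> T m (- l.+1%:Z) u ->
    (u - c * m%:R) / l.+1%:R <= (c * n%:R - t) / k.+1%:R.
  move=> /(TM _ _ _ l) Tk /(TM _ _ _ k) Tl.
  have := TD _ _ _ _ _ _ Tk Tl.
  have -> : k.+1%:Z *+ l.+1 + (- l.+1%:Z) *+ k.+1 = 0 by lia.
  move=> /T0; rewrite natrD !natrM => h.
  rewrite ler_pdivrMr// mulrAC ler_pdivlMr//.
  move: h; rewrite -[t *+ _]mulr_natr -[u *+ _]mulr_natr => h; lra.
(* [Lo] collects the lower bounds on [q] forced by triples at negative height. The triple at height
   [kp > 0] bounds it above, so its supremum is a real slope. *)
pose Lo := [set x : R | exists n (l : nat) t,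
  T n (- l.+1%:Z) t /\ x = (t - c * n%:R) / l.+1%:R].
have kpE : exists a : nat, kp = a.+1%:Z by exists `|kp|.-1%N; lia.
have knE : exists a : nat, kn = - a.+1%:Z by exists `|kn|.-1%N; lia.
case: kpE => a aE; case: knE => b bE; rewrite {}aE in Tp kp0; rewrite {}bE in Tn kn0.
have ubLo : ubound Lo ((c * np%:R - tp) / a.+1%:R).
  by move=> _ [n [l [t [Tnlt ->]]]]; exact: (key _ _ _ _ _ _ Tp Tnlt).
have sLo : has_sup Lo.
  split; last by exists ((c * np%:R - tp) / a.+1%:R).
  by exists ((tn - c * nn%:R) / b.+1%:R); exists nn, b, tn.
exists (sup Lo) => n k t Tnkt.
have [k0|k0|k0] := ltgtP k 0.
- have kE : k = - `|k|.-1.+1%:Z by lia.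
  rewrite kE in Tnkt *; rewrite rmorphN/= mulrN -lerBrDr opprK -lerBlDl.
  by rewrite -ler_pdivrMr//; apply: sup_upper_bound => //; exists n, `|k|.-1%N, t.
- have kE : k = `|k|.-1.+1%:Z by lia.
  rewrite kE in Tnkt *; rewrite -lerBrDl -ler_pdivlMr//.
  apply: sup_le_ub; first by case: sLo.
  by move=> _ [m [l [u [Tmlu ->]]]]; exact: (key _ _ _ _ _ _ Tnkt Tmlu).
- by rewrite k0 in Tnkt *; rewrite mulr0 addr0; exact: T0.
Qed.

End Growth.

(** * Families of words of equal length and their weights *)

Section Words.
Context {R : realType} (I : set nat).
Implicit Types (w u v : seq nat) (W : seq (seq nat)) (s : seq nat -> R).

Definition word_on w := forall i, i \in w -> I i.

Definition word_family (n : nat) W :=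
  uniq W /\ forall w, w \in W -> size w = n /\ word_on w.

Definition word_product W1 W2 := [seq u ++ v | u <- W1, v <- W2].

(* [word_power W m] is the product of [m.+1] copies of [W]. *)
Definition word_power W m := iter m (word_product W) W.

Definition word_sum s W : R := \sum_(w <- W) expR (s w).

Definition superadditive s :=
  forall u v, word_on u -> word_on v -> s u + s v <= s (u ++ v).

Lemma word_on_cat u v : word_on (u ++ v) <-> word_on u /\ word_on v.
Proof.
split=> [uv|[hu hv] i]; last by rewrite mem_cat => /orP[/hu|/hv].
by split=> i iuv; apply: uv; rewrite mem_cat iuv ?orbT.
Qed.

Lemma word_on_cons i w : word_on (i :: w) <-> I i /\ word_on w.
Proof.
split=> [iw|[hi hw] k]; last by rewrite in_cons => /orP[/eqP ->|/hw].
by split=> [|k kw]; apply: iw; rewrite in_cons ?eqxx// kw orbT.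
Qed.

Lemma word_on_seq1 i : I i -> word_on [:: i].
Proof. by move=> Ii k; rewrite inE => /eqP ->. Qed.

(** Equal lengths fix where a concatenation is cut, so distinct pairs give distinct words. *)
Lemma word_family_product n m W1 W2 :
  word_family n W1 -> word_family m W2 -> word_family (n + m) (word_product W1 W2).
Proof.
move=> [u1 h1] [u2 h2]; split.
  apply: allpairs_uniq => // -[a b] [a' b'] /allpairsP[[x y]/= [x1 y2 [-> ->]]].
  move=> /allpairsP[[x' y']/= [x1' y2' [-> ->]]] /= /eqP.
  rewrite eqseq_cat; last by rewrite (h1 _ x1).1 (h1 _ x1').1.
  by move=> /andP[/eqP -> /eqP ->].
move=> w /allpairsP[[x y]/= [x1 y2 ->]]; rewrite size_cat.
have [-> ox] := h1 _ x1; have [-> oy] := h2 _ y2.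
by split=> //; exact/word_on_cat.
Qed.

Lemma word_sum_ge0 s W : 0 <= word_sum s W.
Proof. by apply: sumr_ge0 => w _; exact: expR_ge0. Qed.

Lemma word_sum_product s n m W1 W2 : superadditive s ->
  word_family n W1 -> word_family m W2 ->
  word_sum s W1 * word_sum s W2 <= word_sum s (word_product W1 W2).
Proof.
move=> sa h1 h2.
rewrite /word_sum /word_product big_allpairs_dep/= big_distrl/=.
rewrite big_seq [leRHS]big_seq; apply: ler_sum => u uW.
rewrite big_distrr/= big_seq [leRHS]big_seq; apply: ler_sum => v vW.
by rewrite -expRD ler_expR sa//; [case: (h1.2 _ uW)|case: (h2.2 _ vW)].
Qed.

Lemma word_family_power n W m : word_family n W ->
  word_family (n * m.+1) (word_power W m).
Proof.
move=> h; elim: m => [|m IH]; first by rewrite muln1.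
by rewrite mulnS; exact: word_family_product.
Qed.

Lemma word_sum_power s n W m : superadditive s -> word_family n W ->
  word_sum s W ^+ m.+1 <= word_sum s (word_power W m).
Proof.
move=> sa h; elim: m => [|m IH]; first by rewrite expr1.
rewrite exprS; apply: le_trans (word_sum_product sa h (word_family_power m h)).
by rewrite ler_wpM2l ?word_sum_ge0.
Qed.

Lemma word_power_ind (P : nat -> seq nat -> Prop) W m :
  (forall w, w \in W -> P 0 w) ->
  (forall k u v, u \in W -> P k v -> P k.+1 (u ++ v)) ->
  forall w, w \in word_power W m -> P m w.
Proof.
move=> P1 PS; elim: m => [|m IH] w; first exact: P1.
by move=> /allpairsP[[u v]/= [uW vW ->]]; apply: PS => //; exact: IH.
Qed.

End Words.

(** * Choice of the slope [q] *)

Section Slope.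
Context {R : realType} (I : set nat) (s : seq nat -> R) (p : nat -> int).
Hypothesis sa : superadditive I s.
Implicit Types (w u v : seq nat) (W : seq (seq nat)).

Definition word_step w : int := \sum_(i <- w) p i.

Lemma word_step_cat u v : word_step (u ++ v) = word_step u + word_step v.
Proof. by rewrite /word_step big_cat. Qed.

Definition tilt (q : R) w : R := s w + q * (word_step w)%:~R.

Lemma tilt_superadditive q : superadditive I (tilt q).
Proof.
move=> u v hu hv; rewrite /tilt word_step_cat rmorphD/= mulrDr.
by have := sa hu hv; lra.
Qed.

(** The list [W] is finite, so its steps are bounded even when those over [I] are not; its powers
    thus meet only linearly many levels. *)
Lemma word_power_step_bound W : exists M : nat, forall m w,
  w \in word_power W m -> (`|word_step w| <= M * m.+1)%N.
Proof.
exists (\max_(w <- W) `|word_step w|)%N => m.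
have h w : w \in W -> (`|word_step w| <= \max_(w <- W) `|word_step w|)%N.
  by move=> wW; exact: (@leq_bigmax_seq _ _ xpredT (fun w => `|word_step w|%N)).
move=> w; elim/word_power_ind: w / => [w /h|k u v /h hu hv]; first by rewrite muln1.
by rewrite word_step_cat mulnS; apply: leq_trans (leq_add hu hv); lia.
Qed.

Lemma exists_slope c :
  (exists2 i, I i & 0 < p i) -> (exists2 i, I i & p i < 0) ->
  (forall n W, (0 < n)%N -> word_family I n W ->
     (forall w, w \in W -> word_step w = 0) -> word_sum s W <= expR (c * n%:R)) ->
  exists q : R, forall n W, (0 < n)%N -> word_family I n W ->
     word_sum (tilt q) W <= expR (c * n%:R).
Proof.
move=> [ip Iip pip] [im Iim pim] W0.
(* A lower bound on the weight, rather than its value, survives concatenation, where weights are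
   only supermultiplicative. *)
pose T n k (t : R) := (0 < n)%N /\ exists W, [/\ word_family I n W,
  forall w, w \in W -> word_step w = k & expR t <= word_sum s W].
have T1 i : I i -> T 1%N (p i) (s [:: i]).
  move=> Ii; split=> //; exists [:: [:: i]]; split.
  - by split=> // w; rewrite inE => /eqP ->; split=> //; exact: word_on_seq1.
  - by move=> w; rewrite inE => /eqP ->; rewrite /word_step big_seq1.
  - by rewrite /word_sum big_seq1.
have [|||| q qP] := @separating_slope R T c.
- move=> n k t m l u [n0 [W1 [f1 k1 s1]]] [_ [W2 [f2 k2 s2]]].
  split; first by rewrite addn_gt0 n0.
  exists (word_product W1 W2); split.
  + exact: word_family_product.
  + move=> w /allpairsP[[x y]/= [xW yW ->]].
    by rewrite word_step_cat k1// k2.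
  + rewrite expRD; apply: le_trans (word_sum_product sa f1 f2).
    by rewrite ler_pM ?expR_ge0.
- move=> n t [n0 [W [fW kW sW]]]; rewrite -ler_expR.
  exact: le_trans sW (W0 _ _ n0 fW kW).
- by exists 1%N, (p ip), (s [:: ip]); split=> //; exact: T1.
- by exists 1%N, (p im), (s [:: im]); split=> //; exact: T1.
have level n W k : (0 < n)%N -> word_family I n W ->
    \sum_(w <- W | word_step w == k) expR (tilt q w) <= expR (c * n%:R).
  move=> n0 [uW hW]; rewrite -big_filter.
  set V := [seq w <- W | word_step w == k].
  have kV w : w \in V -> word_step w = k by rewrite mem_filter => /andP[/eqP].
  have fV : word_family I n V.
    by split=> [|w]; [exact: filter_uniq|rewrite mem_filter => /andP[_ /hW]].
  have -> : \sum_(w <- V) expR (tilt q w) = word_sum s V * expR (q * k%:~R).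
    rewrite /word_sum big_distrl/= big_seq [RHS]big_seq; apply: eq_bigr => w wV.
    by rewrite /tilt expRD (kV _ wV).
  (* There may be no word at level [k]; the weight is then 0 and has no useful logarithm. *)
  have [V0|V0] := ltP 0 (word_sum s V); last first.
    by rewrite (@le_trans _ _ 0) ?expR_ge0 ?mulr_le0_ge0 ?expR_ge0.
  rewrite -[word_sum s V]lnK ?posrE// -expRD ler_expR; apply: qP.
  by split=> //; exists V; split=> //; rewrite lnK ?posrE.
exists q => n W n0 fW.
have [M HM] := word_power_step_bound W.
(* The levels of a product of [m.+1] words lie in [[-N, N]] with [N = M * m.+1], and
   [2 N + 1 <= (2 M + 1) * m.+1]. *)
apply: (@le_of_expr_growth _ _ _ (2 * M%:R + 1) 1); first exact: expR_gt0.
case=> // m _.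
apply: le_trans (word_sum_power m (tilt_superadditive q) fW) _.
rewrite /word_sum.
pose N := (M * m.+1)%N.
(* The shift by [N] turns levels into elements of a finite ordinal, over which the sum is split. *)
pose ix w : 'I_(2 * N).+1 := inord `|word_step w + N%:Z|.
rewrite (partition_big ix xpredT)//=.
have ixP (k : 'I_(2 * N).+1) : \sum_(w <- word_power W m | ix w == k)
    expR (tilt q w) <= expR (c * (n * m.+1)%:R).
  apply: le_trans (level _ _ (k%:Z - N%:Z) _ (word_family_power m fW));
    last by rewrite muln_gt0 n0.
  rewrite le_eqVlt; apply/orP; left; apply/eqP.
  rewrite big_seq_cond [RHS]big_seq_cond; apply: eq_bigl => w.
  have [wW|//] := boolP (w \in _); rewrite /=.
  have := HM _ _ wW; rewrite -/N => wN.
  apply/eqP/eqP => [<-|wE].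
    by rewrite /ix inordK; lia.
  by apply: val_inj; rewrite /ix /= wE subrK inordK//= ltn_ord.
apply: le_trans (ler_sum _ (fun k _ => ixP k)) _.
rewrite sumr_const card_ord -[_ *+ _]mulr_natl natrM mulrA expRM_natr.
rewrite ler_wpM2r ?exprn_ge0 ?expR_ge0//.
rewrite /N -natr1 natrM natrM -natr1.
have : 0 <= m%:R :> R by [].
have : 0 <= M%:R :> R by [].
by move=> ? ?; lra.
Qed.

End Slope.

(** * Lipschitz maps and disjoint intervals *)

Section RealLine.
Context {R : realType}.

Lemma lipschitz_within_continuous (A : set R) (f : R -> R) (L : R) :
  (forall x y, A x -> A y -> `|f x - f y| <= L * `|x - y|) ->
  {within A, continuous f}.
Proof.
move=> Lf; apply/subspace_continuousP => x Ax.
apply/cvgrPdist_lt => e e0.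
have L0 : 0 < `|L| + 1 by rewrite ltr_pwDr.
have := nbhsx_ballx x _ (divr_gt0 e0 L0).
apply: filterS => t xt At.
apply: le_lt_trans (Lf _ _ Ax At) _.
move: xt; rewrite /ball/= ltr_pdivlMr//; apply: le_lt_trans.
rewrite mulrC ler_wpM2l//; have := ler_norm L; lra.
Qed.

(** If [y <= x], the larger of [a] and [y] would lie in both intervals. *)
Lemma disjoint_interval_lt (A B : set R) a b :
  is_interval A -> is_interval B -> A `&` B = set0 -> A a -> B b -> a < b ->
  forall x y, A x -> B y -> x < y.
Proof.
move=> iA iB AB Aa Bb ab x y Ax By; rewrite ltNge; apply/negP => yx.
have nAB t : A t -> B t -> False by move=> At Bt; rewrite -[False]/(set0 t) -AB.
have [ya|ay] := leP y a.
  by apply: (nAB a) => //; apply: (iB y b) => //; rewrite ya ltW.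
by apply: (nAB y) => //; apply: (iA a x) => //; rewrite yx ltW.
Qed.

End RealLine.

(** * Cylinders, inverse branches and periodic points of the base map *)

Section Cylinders.
Context {R : realType} (I : set nat) (J : nat -> set R) (F0 : R -> R).
Implicit Types (w u v : seq nat) (x y : R).

(** The empty word gives the whole line, not (0, 1): only a first letter confines a point. *)
Fixpoint cylinder w : set R :=
  if w is i :: w' then [set x | J i x /\ cylinder w' (F0 x)] else setT.

Lemma cylinder_cat u v x :
  cylinder (u ++ v) x <-> cylinder u x /\ cylinder v (iter (size u) F0 x).
Proof.
elim: u x => [|i u IH] x /=; first by split=> [|[]].
rewrite -iterS iterSr; split=> [[Jx /IH[]]|[[Jx cu] cv]]; first by [].
by split=> //; exact/IH.
Qed.

(** The inverse branch along [w]. It is used on (0, 1) only, where a preimage exists and the default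
    0 is not taken. *)
Definition branch w y := xget 0 [set x | cylinder w x /\ iter (size w) F0 x = y].

Local Notation D := (base_domain I J).
Local Notation rep := (repeller F0 D).

Lemma repeller_domain x : rep x -> D x.
Proof. by move=> /(_ 0%N Logic.I). Qed.

Lemma repeller_iter n x : rep x -> rep (iter n F0 x).
Proof. by move=> rx k _ /=; rewrite -iterD; exact: rx. Qed.

Lemma repellerS x : D x -> rep (F0 x) -> rep x.
Proof. by move=> Dx rFx [|n] _ //=; rewrite -iterS iterSr; exact: rFx. Qed.

Lemma repeller_itinerary n x : rep x ->
  exists w, [/\ size w = n, word_on I w & cylinder w x].
Proof.
elim: n x => [|n IH] x rx; first by exists [::].
have [w [wn Iw cw]] := IH _ (repeller_iter 1 rx).
have [i Ii Jx] := repeller_domain rx.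
by exists (i :: w); split; [rewrite /= wn|exact/word_on_cons|].
Qed.

Lemma cylinder_domain w x k : word_on I w -> cylinder w x -> (k < size w)%N ->
  D (iter k F0 x).
Proof.
elim: w x k => // i w IH x [|k] /word_on_cons[Ii Iw] [Jx cx] kw.
  by exists i.
by rewrite iterSr; exact: IH.
Qed.

Lemma periodic_repeller w x : word_on I w -> (0 < size w)%N -> cylinder w x ->
  iter (size w) F0 x = x -> rep x.
Proof.
move=> Iw w0 cx xx n _ /=; have [m] := ubnP n; elim: m n => // m IH n nm.
have [nw|wn] := ltnP n (size w); first exact: (cylinder_domain Iw cx).
by rewrite -(subnK wn) iterD xx; apply: IH; lia.
Qed.

Hypothesis HF0 : base_map I J F0.

Lemma cell_01 i x : I i -> J i x -> 0 < x < 1.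
Proof.
by move=> Ii Jx; have [_ _ _ /(_ _ Jx)] := base_cell HF0 Ii; rewrite /= in_itv.
Qed.

Lemma domain_01 x : D x -> 0 < x < 1.
Proof. by move=> [i Ii]; exact: cell_01. Qed.

Lemma cell_surj i y : I i -> 0 < y < 1 -> exists2 x, J i x & F0 x = y.
Proof.
move=> Ii y01; have : (F0 @` J i) y by rewrite (base_full_branch HF0 Ii) /= in_itv.
by move=> [x Jx <-]; exists x.
Qed.

Lemma cell_image i x : I i -> J i x -> 0 < F0 x < 1.
Proof.
move=> Ii Jx; have : (F0 @` J i) (F0 x) by exists x.
by rewrite (base_full_branch HF0 Ii) /= in_itv.
Qed.

Lemma cell_uniq i k x : I i -> I k -> J i x -> J k x -> i = k.
Proof. by move=> Ii Ik Jx Jx'; apply: (base_disjoint HF0) => //; exists x. Qed.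

Lemma cell_derivable i x : I i -> J i x -> derivable F0 x 1.
Proof.
move=> Ii Jx; have [U [G [JU [_ UG] FG]]] := base_C2 HF0 Ii.
have [dG _ _] := UG _ (JU _ (subset_closure Jx)).
apply: near_eq_derivable dG; have [_ oJ _ _] := base_cell HF0 Ii.
have := open_nbhs_nbhs (conj oJ Jx); apply: filterS => t Jt.
by rewrite FG// inE.
Qed.

(** Mean value theorem inside a cell, with the infimum of [|F0'|] as [L]; this infimum is a real
    number because it exceeds 1 and the cells are non-empty. *)
Lemma cell_expanding : exists2 L : R, 1 < L & forall i x y, I i -> J i x -> J i y ->
  L * `|x - y| <= `|F0 x - F0 y|.
Proof.
have [L L1 LF] : exists2 L : R, 1 < L &
    forall x, D x -> L <= `|(F0^`())%classic x|.
  have := base_expanding HF0; set S := (X in ereal_inf X) => hS.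
  have [i [_ [Ii _ _]]] := base_index_card HF0.
  have [[x Jx] _ _ _] := base_cell HF0 Ii.
  have SF t : D t -> (ereal_inf S <= `|(F0^`())%classic t|%:E)%E.
    by move=> Dt; apply: ereal_inf_lbound; exists t.
  have Sx : (ereal_inf S <= `|(F0^`())%classic x|%:E)%E by apply: SF; exists i.
  have Sfin : ereal_inf S \is a fin_num.
    rewrite fin_numE; apply/andP; split.
      by rewrite gt_eqF// (lt_trans _ hS)// ltNyr.
    by rewrite lt_eqF// (le_lt_trans Sx)// ltry.
  exists (fine (ereal_inf S)); first by rewrite -lte_fin fineK.
  by move=> t Dt; rewrite -lee_fin fineK//; exact: SF.
exists L => // i.
have lt x y : I i -> J i x -> J i y -> x < y -> L * `|x - y| <= `|F0 x - F0 y|.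
  move=> Ii Jx Jy xy; have [_ _ iJ _] := base_cell HF0 Ii.
  have Jt t : t \in `[x, y] -> J i t by rewrite in_itv/= => ?; exact: (iJ x y).
  have [||c cxy] := @MVT R F0 (F0^`())%classic x y xy.
  - move=> t txy; rewrite derive1E; apply: derivableP.
    by apply: (cell_derivable Ii); apply: Jt; apply: subset_itv_oo_cc.
  - by apply: derivable_within_continuous => t /Jt; exact: cell_derivable.
  - move=> /(congr1 (@Num.norm _ _)); rewrite normrM distrC => ->.
    rewrite (distrC x) ler_wpM2r//; apply: LF; exists i => //.
    by apply: Jt; apply: subset_itv_oo_cc.
move=> x y Ii Jx Jy; have [xy|yx|->] := ltgtP x y.
- exact: lt.
- by rewrite distrC (distrC (F0 x)); exact: lt.
- by rewrite !subrr normr0 mulr0.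
Qed.

Lemma cylinder_expanding : exists2 L : R, 1 < L & forall w x y,
  word_on I w -> cylinder w x -> cylinder w y ->
  L ^+ size w * `|x - y| <= `|iter (size w) F0 x - iter (size w) F0 y|.
Proof.
have [L L1 LF] := cell_expanding; exists L => // w.
elim: w => [|i w IH] x y; first by rewrite mul1r.
move=> /word_on_cons[Ii Iw] [Jx cx] [Jy cy].
rewrite [size _]/= !iterSr; apply: le_trans (IH _ _ Iw cx cy).
rewrite exprSr -mulrA ler_wpM2l ?(LF i)//.
by rewrite exprn_ge0// ltW// (lt_trans ltr01 L1).
Qed.

Lemma cylinder_dist w x y : word_on I w -> cylinder w x -> cylinder w y ->
  `|x - y| <= `|iter (size w) F0 x - iter (size w) F0 y|.
Proof.
have [L L1 LF] := cylinder_expanding => Iw cx cy.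
apply: le_trans (LF _ _ _ Iw cx cy).
by rewrite ler_peMl// exprn_ege1// ltW.
Qed.

Lemma cylinder_inj u v x : word_on I u -> word_on I v -> size u = size v ->
  cylinder u x -> cylinder v x -> u = v.
Proof.
elim: u v x => [|i u IH] [|k v] x //= /word_on_cons[Ii Iu] /word_on_cons[Ik Iv] [uv].
by move=> [Jx cx] [Jx' cx']; rewrite (cell_uniq Ii Ik Jx Jx') (IH _ _ Iu Iv uv cx cx').
Qed.

(** Expansion gives [L^n |x - y| <= |x - y|] with [L > 1]. Hence periodic points can be counted by
    their words. *)
Lemma periodic_uniq w x y : word_on I w -> (0 < size w)%N ->
  cylinder w x -> cylinder w y ->
  iter (size w) F0 x = x -> iter (size w) F0 y = y -> x = y.
Proof.
have [L L1 LF] := cylinder_expanding => Iw w0 cx cy xx yy.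
have := LF _ _ _ Iw cx cy; rewrite xx yy => h.
apply/eqP; rewrite -subr_eq0 -normr_le0 leNgt; apply/negP => xy0.
move: h; rewrite -ler_pdivlMr// divff ?gt_eqF//.
by rewrite leNgt exprn_egt1// -lt0n w0.
Qed.

(** Pulls [y] back through one full branch at a time. The last clause supplies points of the
    repeller at which Birkhoff sums can be evaluated. *)
Lemma cylinder_surj w y : word_on I w -> 0 < y < 1 ->
  exists x, [/\ cylinder w x, iter (size w) F0 x = y & rep y -> rep x].
Proof.
move=> + y01; elim: w => [|i w IH]; first by exists y.
move=> /word_on_cons[Ii Iw]; have [z [cz zy yz]] := IH Iw.
have z01 : 0 < z < 1.
  case: w {IH} Iw cz zy {yz} => [_ _ /= ->//|k w /word_on_cons[Ik _] [Jz _] _].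
  exact: (cell_01 Ik).
have [x Jx xz] := cell_surj Ii z01.
exists x; split; first by split=> //; rewrite xz.
  by rewrite /= -iterS iterSr xz.
by move=> /yz rz; apply: repellerS; [exists i|rewrite xz].
Qed.

Lemma branchP w y : word_on I w -> 0 < y < 1 ->
  cylinder w (branch w y) /\ iter (size w) F0 (branch w y) = y.
Proof.
move=> Iw y01; rewrite /branch; case: xgetP => [x -> []//|/= nx].
by have [x [cx xy _]] := cylinder_surj Iw y01; have := nx x (conj cx xy).
Qed.

Lemma branch_dist w y z : word_on I w -> 0 < y < 1 -> 0 < z < 1 ->
  `|branch w y - branch w z| <= `|y - z|.
Proof.
move=> Iw y01 z01; have [cy yE] := branchP Iw y01; have [cz zE] := branchP Iw z01.
by have := cylinder_dist Iw cy cz; rewrite yE zE.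
Qed.

(** This subcell is the image of the interval [J k] under the inverse branch of [i], which is
    continuous since expansion makes it 1-Lipschitz. *)
Lemma cylinder2_interval i k : I i -> I k -> is_interval (cylinder [:: i; k]).
Proof.
move=> Ii Ik; have Iw := word_on_seq1 Ii.
have -> : cylinder [:: i; k] = branch [:: i] @` J k.
  apply/seteqP; split=> x /=.
    move=> [Jx [Jx' _]]; exists (F0 x) => //.
    have [cb bE] := branchP Iw (cell_01 Ik Jx').
    have := cylinder_dist Iw cb (conj Jx Logic.I : cylinder [:: i] x).
    by rewrite bE subrr normr0 normr_le0 subr_eq0 => /eqP.
  move=> [y Jy <-]; have [[Jb _] bE] := branchP Iw (cell_01 Ik Jy).
  by split=> //; split=> //; move: bE => /= ->.
apply/connected_intervalP; apply: connected_continuous_connected.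
  by apply/connected_intervalP; have [] := base_cell HF0 Ik.
apply: (@lipschitz_within_continuous _ _ _ 1) => x y Jx Jy; rewrite mul1r.
by apply: branch_dist => //; exact: (cell_01 Ik).
Qed.

(* Of two disjoint cells, let [i] be the lower one; the two subcells [ii] and
   [ik] of [i] are disjoint, and the upper one stays away from both 0 and 1. *)
Lemma exists_compact_word : exists v (a b : R),
  [/\ word_on I v, (0 < size v)%N, 0 < a <= b, b < 1
    & forall x, cylinder v x -> a <= x <= b].
Proof.
have [i [k [Ii Ik ik]]] := base_index_card HF0.
have [[x Jx] _ _ _] := base_cell HF0 Ii; have [[y Jy] _ _ _] := base_cell HF0 Ik.
have nik l m t : I l -> I m -> l <> m -> J l t -> J m t -> False.
  by move=> Il Im lm Jl Jm; apply: lm; exact: (cell_uniq Il Im Jl Jm).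
wlog xy : i k x y Ii Ik ik Jx Jy / x < y.
  move=> wl; have [xy|yx|xy] := ltgtP x y; first exact: (wl i k x y).
    by apply: (wl k i y x) => // ki; apply: ik.
  by exfalso; apply: (nik i k x) => //; rewrite xy.
have below t : J i t -> t < y.
  move=> Jt; have [_ _ iJi _] := base_cell HF0 Ii; have [_ _ iJk _] := base_cell HF0 Ik.
  apply: (disjoint_interval_lt iJi iJk _ Jx Jy xy Jt Jy).
  by rewrite -subset0 => z [Jz Jz']; exact: (nik i k z).
have x01 := cell_01 Ii Jx; have y01 := cell_01 Ik Jy.
have [p Jp pE] := cell_surj Ii x01; have [q Jq qE] := cell_surj Ii y01.
have p01 := cell_01 Ii Jp; have q01 := cell_01 Ii Jq.
have cp : cylinder [:: i; i] p by rewrite /= pE.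
have cq : cylinder [:: i; k] q by rewrite /= qE.
have dis : cylinder [:: i; i] `&` cylinder [:: i; k] = set0.
  by rewrite -subset0 => z [[_ [Jz _]] [_ [Jz' _]]]; exact: (nik i k (F0 z)).
have Iii : word_on I [:: i; i].
  by apply/word_on_cons; split=> //; exact: word_on_seq1.
have Iik : word_on I [:: i; k].
  by apply/word_on_cons; split=> //; exact: word_on_seq1.
(* The order of the two subcells depends on whether [F0] increases on [J i]. A point of the lower
   one bounds the upper one below, and [y] bounds all of [J i] above. *)
have [pq|qp|pq] := ltgtP p q; last first.
- exfalso; apply: (nik i k (F0 p)) => //; first by rewrite pE.
  by rewrite pq qE.
- have lt := disjoint_interval_lt (cylinder2_interval Ii Ik) (cylinder2_interval Ii Ii)
    (etrans (setIC _ _) dis) cq cp qp.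
  exists [:: i; i], q, y; split=> //.
  + by case/andP: q01 => -> _; rewrite ltW// below.
  + by case/andP: y01.
  + by move=> t ct; rewrite ltW ?(lt _ _ cq ct)//= ltW// below//; case: ct.
- have lt := disjoint_interval_lt (cylinder2_interval Ii Ii) (cylinder2_interval Ii Ik)
    dis cp cq pq.
  exists [:: i; k], p, y; split=> //.
  + by case/andP: p01 => -> _; rewrite ltW// below.
  + by case/andP: y01.
  + by move=> t ct; rewrite ltW ?(lt _ _ cp ct)//= ltW// below//; case: ct.
Qed.

(** The branch along [v ++ u2 ++ u1] maps [[a, b]] into the cylinder of [v], hence into [[a, b]],
    and so has a fixed point there by the intermediate value theorem. *)
Lemma exists_periodic_word : exists v, [/\ word_on I v, (0 < size v)%N &
  forall u1 u2, word_on I u1 -> word_on I u2 ->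
  exists x, [/\ cylinder (u1 ++ v ++ u2) x,
    iter (size (u1 ++ v ++ u2)) F0 x = x & rep x]].
Proof.
have [v [a [b [Iv v0 /andP[a0 ab] b1 vab]]]] := exists_compact_word.
exists v; split=> // u1 u2 Iu1 Iu2.
set w := v ++ (u2 ++ u1).
have Iw : word_on I w by do 2 (apply/word_on_cat; split=> //).
have t01 t : a <= t <= b -> 0 < t < 1.
  by move=> /andP[? ?]; apply/andP; split; [exact: lt_le_trans a0 _|exact: le_lt_trans b1].
have bab t : a <= t <= b -> a <= branch w t <= b.
  by move=> /t01 tt; apply: vab; have [/cylinder_cat[]] := branchP Iw tt.
have [c cab fc] : exists2 c, c \in `[a, b] & branch w c - c = 0.
  apply: (@IVT R (fun t => branch w t - t)) => //.
    apply: (@lipschitz_within_continuous _ _ _ 2) => x y /=; rewrite !in_itv/= => xab yab.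
    rewrite opprD addrACA -opprD; apply: le_trans (ler_normB _ _) _.
    by have := branch_dist Iw (t01 _ xab) (t01 _ yab); lra.
  have /bab/andP[ha _] : a <= a <= b by rewrite lexx.
  have /bab/andP[_ hb] : a <= b <= b by rewrite lexx ab.
  by rewrite ge_min le_max !subr_le0 !subr_ge0 ha hb !orbT.
have cE : branch w c = c by apply/eqP; rewrite -subr_eq0 fc.
have [] := branchP Iw (t01 c cab); rewrite {}cE => cw wc.
have rc : rep c.
  by apply: (periodic_repeller Iw _ cw wc); rewrite size_cat (leq_trans v0)// leq_addr.
have [c1 c2] : cylinder (v ++ u2) c /\ cylinder u1 (iter (size (v ++ u2)) F0 c).
  by apply/cylinder_cat; rewrite -catA.
(* After [v ++ u2] the orbit of [c] follows [u1] back to [c], so from this point on it reads the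
   rotated word [u1 ++ v ++ u2]. *)
exists (iter (size (v ++ u2)) F0 c).
have back : iter (size u1) F0 (iter (size (v ++ u2)) F0 c) = c.
  by rewrite -iterD -[RHS]wc /w !size_cat; congr (iter _ _ _); lia.
split; last exact: repeller_iter.
  by apply/cylinder_cat; rewrite back.
by rewrite size_cat addnC iterD back.
Qed.

End Cylinders.

(** * Upper limits of logarithmic growth rates *)

Section UpperLimit.
Context {R : realType}.
Implicit Types (Z : nat -> \bar R) (c : R).

(** Lets pressures, which may be infinite, be compared through real rates [c] only. *)
Lemma le_of_lt_EFin (a b : \bar R) :
  (forall c, (b < c%:E)%E -> (a <= c%:E)%E) -> (a <= b)%E.
Proof.
case: b => [b| |] ab; last 2 first.
- by rewrite leey.
- case: a ab => [a| |] ab //; last by have := ab 0 (ltNyr _).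
  by move: ab => /(_ (a - 1)%R (ltNyr _)); rewrite lee_fin leNgt gtrBl ltr01.
apply/lee_addgt0Pr => e e0; rewrite -EFinD; apply: ab.
by rewrite lte_fin ltrDl.
Qed.

Lemma lne_leE (z : \bar R) (a : R) : (0 <= z)%E ->
  (lne z <= a%:E)%E = (z <= (expR a)%:E)%E.
Proof.
move=> z0; rewrite -[a%:E]expeRK lee_lne//.
  by rewrite in_itv/= z0 leey.
by rewrite in_itv/= leey lee_fin expR_ge0.
Qed.

Lemma limn_esup_lne_le Z c (B : R) :
  (forall n, (0 < n)%N -> (0 <= Z n <= (expR (B + c * n%:R))%:E)%E) ->
  (limn_esup (fun n => (n%:R^-1)%:E * lne (Z n)) <= c%:E)%E.
Proof.
move=> ZB; apply/lee_addgt0Pr => e e0.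
(* From [n0] on, the constant contributes [B / n <= e]. *)
pose n0 := (Num.trunc (`|B| / e)).+1.
have V0 : \oo [set n | (n0 <= n)%N] by exact: nbhs_infty_ge.
apply: (@le_trans _ _ (ereal_sup [set ((n%:R^-1)%:E * lne (Z n))%E
    | n in [set n | (n0 <= n)%N]])).
  by apply: ereal_inf_lbound; exists [set n | (n0 <= n)%N].
apply/ereal_supP => _ [n /= n0n <-].
have np : (0 < n)%N by apply: leq_trans n0n.
have nR : 0 < n%:R :> R by rewrite ltr0n.
have /andP[Z0 ZE] := ZB n np.
rewrite lee_pdivrMl//; apply: (@le_trans _ _ (B + c * n%:R)%:E).
  by rewrite lne_leE.
rewrite -EFinD -EFinM lee_fin mulrDr addrC mulrC lerD2l.
have : `|B| / e < n%:R.
  by apply: lt_le_trans (truncnS_gt _) _; rewrite ler_nat.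
by rewrite ltr_pdivrMr// => /ltW; apply: le_trans; exact: ler_norm.
Qed.

Lemma limn_esup_lne_lt Z c : (forall n, (0 <= Z n)%E) ->
  (limn_esup (fun n => (n%:R^-1)%:E * lne (Z n)) < c%:E)%E ->
  exists n0, forall n, (n0 <= n)%N -> (Z n <= (expR (c * n%:R))%:E)%E.
Proof.
move=> Z0 /ereal_inf_lt[_ [V [n0 _ n0V] <-] Vc].
(* The successor keeps [n] positive, so the division by [n] can be undone. *)
exists n0.+1 => n n0n.
have nR : 0 < n%:R :> R by rewrite ltr0n (leq_trans _ n0n).
have : ((n%:R^-1)%:E * lne (Z n) <= c%:E)%E.
  apply/ltW/(le_lt_trans _ Vc)/ereal_sup_ubound; exists n => //.
  by apply: n0V => /=; exact: ltnW.
by rewrite lee_pdivrMl// -EFinM mulrC lne_leE.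
Qed.

End UpperLimit.

(** * Birkhoff sums along orbits *)

Section BirkhoffSums.
Context {R : realType}.
Implicit Types (f g : R -> R).

Lemma birkhoff_sum_add f g m n x : birkhoff_sum f g (m + n) x =
  birkhoff_sum f g m x + birkhoff_sum f g n (iter m f x).
Proof.
rewrite /birkhoff_sum big_split_ord/=; congr (_ + _).
by apply: eq_bigr => k _; rewrite -iterD addnC.
Qed.

Lemma birkhoff_sumS f g n x :
  birkhoff_sum f g n.+1 x = g x + birkhoff_sum f g n (f x).
Proof.
by rewrite -add1n birkhoff_sum_add /birkhoff_sum big_ord_recl big_ord0 addr0.
Qed.

Definition step_sum f (psi : R -> int) n x : int := \sum_(k < n) psi (iter k f x).

Lemma step_sumS f psi n x : step_sum f psi n.+1 x = psi x + step_sum f psi n (f x).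
Proof.
rewrite /step_sum big_ord_recl; congr (_ + _).
by apply: eq_bigr => k _; rewrite -iterSr.
Qed.

Lemma step_sumSr f psi n x :
  step_sum f psi n.+1 x = step_sum f psi n x + psi (iter n f x).
Proof. by rewrite /step_sum big_ord_recr. Qed.

Lemma birkhoff_sum_tilt f g psi (q : R) n x :
  birkhoff_sum f (fun x => g x + q * (psi x)%:~R) n x =
  birkhoff_sum f g n x + q * (step_sum f psi n x)%:~R.
Proof.
by rewrite /birkhoff_sum /step_sum big_split/= -mulr_sumr rmorph_sum.
Qed.

End BirkhoffSums.

(** * Bounded distortion and superadditive weights *)

Section Weights.
Context {R : realType} (I : set nat) (J : nat -> set R) (F0 : R -> R) (g : R -> R).
Hypothesis HF0 : base_map I J F0.
Hypothesis Hg : holder I J F0 g.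
Implicit Types (w u v : seq nat) (x y : R).

Local Notation rep := (repeller F0 (base_domain I J)).
Local Notation cylinder := (cylinder J F0).

(** Two orbits sharing [j] more letters are within [L^-j] of each other, so Hölder continuity bounds
    the difference by a geometric series of ratio [r = L^-alpha]. *)
Lemma birkhoff_distortion : exists D : R, forall w x y, word_on I w ->
  cylinder w x -> cylinder w y -> rep x -> rep y ->
  `|birkhoff_sum F0 g (size w) x - birkhoff_sum F0 g (size w) y| <= D.
Proof.
have [L L1 LF] := cylinder_expanding HF0.
have [alpha [C [/andP[a0 _] gH]]] := Hg.
have L0 : 0 < L by exact: lt_trans L1.
pose r := L^-1 `^ alpha.
have r0 : 0 <= r by exact: powR_ge0.
have r1 : r < 1.
  have := @gt0_ltr_powR _ _ a0 L^-1 1; rewrite powR1; apply.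
  - by rewrite nnegrE invr_ge0 ltW.
  - by rewrite nnegrE.
  - by rewrite invf_lt1.
have r1' : 0 < 1 - r by rewrite subr_gt0.
pose D := `|C| * r / (1 - r).
have D0 : 0 <= D by rewrite !mulr_ge0// invr_ge0 ltW.
exists D => w x y Iw cx cy rx ry.
(* The partial geometric sum, unlike its limit [D], is a bound that passes through the induction on
   [w]. *)
suff : `|birkhoff_sum F0 g (size w) x - birkhoff_sum F0 g (size w) y|
    <= D * (1 - r ^+ size w).
  by move=> /le_trans; apply; rewrite ler_piMr// gerBl exprn_ge0.
elim: w x y Iw cx cy rx ry => [|i w IH] x y Iw cx cy rx ry.
  by rewrite /birkhoff_sum !big_ord0 subrr normr0 subrr mulr0.
have [Ii Iw'] := (word_on_cons _ _ _).1 Iw.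
have dxy : `|x - y| <= L^-1 ^+ (size w).+1.
  rewrite exprVn -[leRHS]mul1r ler_pdivlMr ?exprn_gt0// mulrC.
  apply: le_trans (LF _ _ _ Iw cx cy) _.
  have [k Ik /(cell_01 HF0 Ik) h1] := repeller_domain (repeller_iter (size (i :: w)) rx).
  have [l Il /(cell_01 HF0 Il) h2] := repeller_domain (repeller_iter (size (i :: w)) ry).
  by rewrite ler_norml; move: h1 h2 => /andP[? ?] /andP[? ?]; apply/andP; split; lra.
have gxy : `|g x - g y| <= `|C| * r ^+ (size w).+1.
  have [Jx _] := cx; have [Jy _] := cy.
  apply: le_trans (gH _ Ii _ _ (conj rx Jx) (conj ry Jy)) _.
  apply: (@le_trans _ _ (`|C| * `|x - y| `^ alpha)).
    by rewrite ler_wpM2r ?powR_ge0// ler_norm.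
  rewrite ler_wpM2l// /r -powR_mulrn ?powR_ge0// -powRrM mulrC powRrM.
  rewrite powR_mulrn ?invr_ge0 ?(ltW L0)//.
  by rewrite ge0_ler_powR ?nnegrE ?exprn_ge0 ?invr_ge0 ?(ltW L0) ?(ltW a0).
have := IH _ _ Iw' cx.2 cy.2 (repeller_iter 1 rx) (repeller_iter 1 ry).
rewrite [size (i :: w)]/= !birkhoff_sumS opprD addrACA => h.
apply: le_trans (ler_normD _ _) _; apply: le_trans (lerD gxy h) _.
rewrite le_eqVlt; apply/orP; left; apply/eqP.
by rewrite /D exprS; field; rewrite gt_eqF.
Qed.

Lemma exists_repeller : exists x, rep x.
Proof.
have [v [_ _ /(_ [::] [::])]] := exists_periodic_word HF0.
by case=> // x [_ _ rx]; exists x.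
Qed.

(** A Birkhoff sum at a chosen point of each cylinder is additive up to [2 D], one [D] per factor.
    Lowering it by [2 D] gives exact superadditivity and raises the distortion to [3 D]. *)
Lemma exists_superadditive_weight : exists (s : seq nat -> R) (D : R),
  superadditive I s /\
  forall w x, word_on I w -> cylinder w x -> rep x ->
    `|birkhoff_sum F0 g (size w) x - s w| <= D.
Proof.
have [D HD] := birkhoff_distortion; have [z0 rz0] := exists_repeller.
have /choice[z zP] : forall w, exists x, word_on I w -> cylinder w x /\ rep x.
  move=> w; have [Iw|nIw] := pselect (word_on I w); last by exists 0.
  have [i Ii Jz] := repeller_domain rz0.
  by have [x [cx _ rx]] := cylinder_surj HF0 Iw (cell_01 HF0 Ii Jz); exists x; auto.
pose s w := birkhoff_sum F0 g (size w) (z w) - 2 * D.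
exists s, (3 * D); split.
  move=> u v Iu Iv; have Iuv : word_on I (u ++ v) by exact/word_on_cat.
  have [/cylinder_cat[cu cv] ruv] := zP _ Iuv.
  have [cu' ru'] := zP _ Iu; have [cv' rv'] := zP _ Iv.
  have := HD _ _ _ Iu cu cu' ruv ru'.
  have := HD _ _ _ Iv cv cv' (repeller_iter _ ruv) rv'.
  rewrite /s size_cat birkhoff_sum_add !ler_norml => /andP[? ?] /andP[? ?].
  by lra.
move=> w x Iw cx rx; have [cw rw] := zP _ Iw.
have := HD _ _ _ Iw cx cw rx rw.
by rewrite /s !ler_norml => /andP[? ?]; apply/andP; split; lra.
Qed.

End Weights.

(** * The step length as a function of letters *)

Section Steps.
Context {R : realType} (I : set nat) (J : nat -> set R) (F0 : R -> R) (psi : R -> int).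
Hypothesis HF0 : base_map I J F0.
Hypothesis Hpsi : step_length I J psi.
Implicit Types (w u v : seq nat) (x y : R).

Local Notation cylinder := (cylinder J F0).

Definition cell_step (i : nat) : int := psi (xget 0 (J i)).

Lemma cell_stepE i x : I i -> J i x -> psi x = cell_step i.
Proof.
by move=> Ii Jx; apply: (step_constant Hpsi Ii) => //; case: xgetP => [y -> //|/(_ x)].
Qed.

Lemma cylinder_step w x : word_on I w -> cylinder w x ->
  step_sum F0 psi (size w) x = word_step cell_step w.
Proof.
elim: w x => [|i w IH] x; first by rewrite /word_step /step_sum big_ord0 big_nil.
move=> /word_on_cons[Ii Iw] [Jx cx].
by rewrite [size _]/= step_sumS (cell_stepE Ii Jx) (IH _ Iw cx) /word_step big_cons.
Qed.

(** An integer-valued function bounded below by -1 that misses -1 is nonnegative, so its infimum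
    could not be -1. *)
Lemma exists_down_cell : exists2 i, I i & cell_step i = -1.
Proof.
have inf1 := step_inf Hpsi.
apply: contrapT => nI.
have : (0%:E <= ereal_inf [set ((psi x)%:~R : R)%:E | x in base_domain I J])%E.
  apply/ereal_infP => _ [x [i Ii Jx] <-].
  have : ((-1)%:E <= ((psi x)%:~R : R)%:E)%E.
    by rewrite -inf1; apply: ereal_inf_lbound; exists x => //; exists i.
  rewrite !lee_fin -[-1]/((-1)%:~R) ler_int ler0z => h.
  have : psi x <> -1 by move=> px; apply: nI; exists i => //; rewrite -(cell_stepE Ii Jx).
  by lia.
by rewrite inf1 lee_fin oppr_ge0 leNgt ltr01.
Qed.

Lemma exists_up_cell : exists2 i, I i & 0 < cell_step i.
Proof.
have [_ [x [i Ii Jx] <-]] := ereal_sup_gt (step_sup Hpsi).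
by rewrite lte_fin ltr0z (cell_stepE Ii Jx); exists i.
Qed.

Lemma word_step_nseq (p : nat -> int) n i : word_step p (nseq n i) = p i *+ n.
Proof. by rewrite /word_step big_nseq iter_addr_0. Qed.

(** Enough copies of an up letter reach or pass [k]; letters of step -1 then remove the excess one
    unit at a time. *)
Lemma exists_word_step (k : int) : exists2 u, word_on I u & word_step cell_step u = k.
Proof.
have [d Id pd] := exists_down_cell; have [e Ie pe] := exists_up_cell.
exists (nseq `|k| e ++ nseq `|cell_step e *+ `|k| - k| d)%N.
  by apply/word_on_cat; split=> i; rewrite mem_nseq => /andP[_ /eqP ->].
rewrite word_step_cat !word_step_nseq pd.
have : 0 <= cell_step e *+ `|k| - k by rewrite -mulr_natr; nia.
by lia.
Qed.

End Steps.

(** * Pressure restricted to a set of levels *)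

Section LevelPressure.
Context {R : realType} (I : set nat) (J : nat -> set R) (F0 : R -> R).
Context (psi : R -> int) (g : R -> R).
Hypothesis HF0 : base_map I J F0.
Hypothesis Hpsi : step_length I J psi.
Implicit Types (w u v : seq nat) (W : seq (seq nat)) (x y q c : R) (N : set int).

Local Notation D := (base_domain I J).
Local Notation rep := (repeller F0 D).
Local Notation cylinder := (cylinder J F0).
Local Notation p := (cell_step J psi).

Definition level_points N i n : set R :=
  periodic_points F0 D n `&` J i `&` [set x | N (step_sum F0 psi n x)].

(* [N = setT] gives the pressure of the base map and [N = [set 0]] that of the
   extension. *)
Definition level_pressure N i (G : R -> R) : \bar R :=
  limn_esup (fun n => ((n%:R^-1)%:E *
    lne (\esum_(x in level_points N i n) (expR (birkhoff_sum F0 G n x))%:E))%E).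

Definition tilted q x : R := g x + q * (psi x)%:~R.

Context (s : seq nat -> R) (K : R).
Hypothesis sa : superadditive I s.
Hypothesis sK : forall w x, word_on I w -> cylinder w x -> rep x ->
  `|birkhoff_sum F0 g (size w) x - s w| <= K.

Lemma tilted_weight q w x : word_on I w -> cylinder w x -> rep x ->
  `|birkhoff_sum F0 (tilted q) (size w) x - tilt s p q w| <= K.
Proof.
move=> Iw cx rx; rewrite birkhoff_sum_tilt (cylinder_step Hpsi Iw cx).
by rewrite /tilt opprD addrACA subrr addr0; exact: sK.
Qed.

(** Expansion makes the itinerary map injective on points of period [n], so a finite set of them
    becomes a word family. Passing to word weights costs a factor [exp K], invisible to the growth
    rate. *)
Lemma level_pressure_le N i q c :
  (forall n W, (0 < n)%N -> word_family I n W ->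
     (forall w, w \in W -> N (word_step p w)) ->
     word_sum (tilt s p q) W <= expR (c * n%:R)) ->
  (level_pressure N i (tilted q) <= c%:E)%E.
Proof.
move=> HW; apply: (@limn_esup_lne_le _ _ _ K) => n n0; apply/andP; split.
  by apply: esum_ge0 => x _; rewrite lee_fin expR_ge0.
apply/ereal_supP => _ [X [finX XS] <-].
rewrite fsbig_finite//= sumEFin lee_fin.
have /choice[itin itinP] : forall x, exists w, rep x ->
    [/\ size w = n, word_on I w & cylinder w x].
  move=> x; have [rx|nrx] := pselect (rep x); last by exists [::].
  by have [w hw] := repeller_itinerary n rx; exists w.
set xs := finmap.enum_fset (fset_set X).
have xsP x : x \in xs -> level_points N i n x.
  by rewrite /xs in_fset_set// inE => /XS.
pose W := map itin xs.
have fW : word_family I n W.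
  split; last by move=> _ /mapP[x /xsP[[[rx _] _] _] ->]; have [] := itinP _ rx.
  rewrite map_inj_in_uniq ?finmap.fset_uniq// => x y.
  move=> /xsP[[[rx xx] _] _] /xsP[[[ry yy] _] _] xy.
  have [sx Ix cx] := itinP _ rx; have [_ _ cy] := itinP _ ry.
  by apply: (periodic_uniq HF0 Ix); rewrite ?sx// xy.
have NW w : w \in W -> N (word_step p w).
  move=> /mapP[x /xsP[[[rx _] _] Nx] ->]; have [sx Ix cx] := itinP _ rx.
  by rewrite -(cylinder_step Hpsi Ix cx) sx.
rewrite expRD; apply: (@le_trans _ _ (expR K * word_sum (tilt s p q) W)); last first.
  by rewrite ler_wpM2l ?expR_ge0// HW.
rewrite /word_sum /W big_map big_distrr/= big_seq [leRHS]big_seq.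
apply: ler_sum => x /xsP[[[rx _] _] _]; rewrite -expRD ler_expR.
have [sx Ix cx] := itinP _ rx.
by have := tilted_weight q Ix cx rx; rewrite sx ler_norml => /andP[? ?]; lra.
Qed.

(** The prefix [u] turns every word into a periodic point of [J i] on the same level, at a constant
    cost. Applying this to powers of [W] reaches the large periods that the upper limit controls,
    and removes the constant; additivity of [N] keeps the powers at admissible levels. *)
Lemma lt_level_pressure N i q c : I i ->
  N 0 -> (forall k l, N k -> N l -> N (k + l)) ->
  (level_pressure N i (tilted q) < c%:E)%E ->
  forall n W, (0 < n)%N -> word_family I n W ->
     (forall w, w \in W -> N (word_step p w)) ->
     word_sum (tilt s p q) W <= expR (c * n%:R).
Proof.
move=> Ii N0 ND Pc n W n0 fW NW.
have [m0 Zc] : exists n0, forall n, (n0 <= n)%N ->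
    (\esum_(x in level_points N i n) (expR (birkhoff_sum F0 (tilted q) n x))%:E
      <= (expR (c * n%:R))%:E)%E.
  apply: limn_esup_lne_lt Pc => k.
  by apply: esum_ge0 => x _; rewrite lee_fin expR_ge0.
have [v [Iv v0 vP]] := exists_periodic_word HF0.
(* [u2] cancels the steps of [i :: v], so that the prefix has total step 0. *)
have [u2 Iu2 pu2] := exists_word_step Hpsi (- word_step p (i :: v)).
set u := (i :: v) ++ u2.
have Iu : word_on I u by apply/word_on_cat; split=> //; exact/word_on_cons.
have pu : word_step p u = 0 by rewrite word_step_cat pu2 subrr.
have /choice[pt ptP] : forall w, exists x, word_on I w ->
    [/\ cylinder (u ++ w) x, iter (size (u ++ w)) F0 x = x & rep x].
  move=> w; have [Iw|nIw] := pselect (word_on I w); last by exists 0.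
  have [x] := vP [:: i] (u2 ++ w) (word_on_seq1 Ii) ((word_on_cat _ _ _).2 (conj Iu2 Iw)).
  by rewrite catA -cat1s catA => hx; exists x.
(* [A] collects the distortion, the weight of the prefix and its extra length. *)
pose A := expR (K - tilt s p q u + c * (size u)%:R).
apply: (@le_of_expr_growth _ _ _ A m0.+1); first exact: expR_gt0.
case=> // m m0m; apply: (@le_trans _ _ (A * expR (c * n%:R) ^+ m.+1)); last first.
  rewrite -mulrA ler_wpM2l ?expR_ge0// ler_peMl ?exprn_ge0 ?expR_ge0//.
  by rewrite ler1n.
have taS := tilt_superadditive p sa q.
apply: le_trans (word_sum_power m taS fW) _.
have [uV VP] := word_family_power m fW.
set V := word_power W m in uV VP *.
have NV w : w \in V -> N (word_step p w).
  move=> wV; apply: (@word_power_ind (fun _ w => N (word_step p w)) W m) wV => //.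
  by move=> _ a b aW Nb; rewrite word_step_cat; apply: ND => //; exact: NW.
set l := (size u + n * m.+1)%N.
have sV w : w \in V -> size (u ++ w) = l by move=> /VP[sw _]; rewrite size_cat sw.
have ptV w : w \in V -> level_points N i l (pt w).
  move=> wV; have [_ Iw] := VP _ wV; have [cw ww rw] := ptP _ Iw.
  split; [split|].
  - by split=> //; rewrite -(sV _ wV).
  - by move: cw; rewrite /u /= => -[].
  - have Iuw : word_on I (u ++ w) by exact/word_on_cat.
    by rewrite /= -(sV _ wV) (cylinder_step Hpsi Iuw cw) word_step_cat pu add0r; exact: NV.
have ptI : {in V &, injective pt}.
  move=> w w' wV wV' ptE; have [_ Iw] := VP _ wV; have [_ Iw'] := VP _ wV'.
  have [cw _ _] := ptP _ Iw; have [cw' _ _] := ptP _ Iw'.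
  have : u ++ w = u ++ w'.
    apply: (cylinder_inj HF0 _ _ _ cw); rewrite ?ptE//; try exact/word_on_cat.
    by rewrite !sV.
  by move=> /eqP; rewrite eqseq_cat// eqxx => /eqP.
have lm : (m0 <= l)%N by rewrite /l; nia.
have Zl : \sum_(w <- V) expR (birkhoff_sum F0 (tilted q) l (pt w)) <= expR (c * l%:R).
  rewrite -lee_fin; apply: le_trans (Zc _ lm).
  apply: esum_ge; exists [set` map pt V].
    by split; [exact: finite_seq|move=> _ /= /mapP[w wV ->]; exact: ptV].
  rewrite -fsbig_seq; last by rewrite map_inj_in_uniq.
  by rewrite big_map sumEFin.
have -> : A * expR (c * n%:R) ^+ m.+1 = expR (K - tilt s p q u) * expR (c * l%:R).
  by rewrite /A -expRM_natr -!expRD /l natrD natrM; congr expR; ring.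
rewrite -ler_pdivrMl ?expR_gt0// -expRN; apply: le_trans Zl.
rewrite /word_sum big_distrr/= big_seq [leRHS]big_seq; apply: ler_sum => w wV.
have [_ Iw] := VP _ wV; have [cw _ rw] := ptP _ Iw.
have Iuw : word_on I (u ++ w) by exact/word_on_cat.
rewrite -expRD ler_expR.
have := tilted_weight q Iuw cw rw; rewrite (sV _ wV) ler_norml => /andP[? ?].
by have := taS _ _ Iu Iw; lra.
Qed.

Lemma base_pressureE i G : base_pressure I J F0 i G = level_pressure setT i G.
Proof.
rewrite /base_pressure /pressure /level_pressure; congr (limn_esup _).
by apply/funext => n; rewrite /level_points setIT.
Qed.

Local Notation FZ := (extension F0 psi).
Local Notation DZ := (extension_domain I J).

Lemma floor_shift x (h : int) : 0 < x < 1 -> Num.floor (x + h%:~R) = h.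
Proof.
move=> /andP[x0 x1]; apply: floor_def; rewrite rmorphD/=.
by apply/andP; split; lra.
Qed.

Lemma frac_part_shift x (h : int) : 0 < x < 1 -> frac_part (x + h%:~R) = x.
Proof. by move=> x01; rewrite /frac_part floor_shift// addrK. Qed.

Lemma extension_shift x (h : int) : 0 < x < 1 ->
  FZ (x + h%:~R) = F0 x + (psi x + h)%:~R.
Proof.
by move=> x01; rewrite /extension frac_part_shift// floor_shift// rmorphD/= addrA.
Qed.

Lemma shift_inj x y (h k : int) : 0 < x < 1 -> 0 < y < 1 ->
  x + h%:~R = y + k%:~R -> x = y /\ h = k.
Proof.
move=> x01 y01 xy; have hk : h = k by rewrite -(floor_shift h x01) xy floor_shift.
by move: xy; rewrite hk => /addIr.
Qed.

Lemma iter_extension n x (h : int) : (forall k, (k < n)%N -> D (iter k F0 x)) ->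
  iter n FZ (x + h%:~R) = iter n F0 x + (step_sum F0 psi n x + h)%:~R.
Proof.
elim: n => [|n IH] Dx; first by rewrite /step_sum big_ord0 add0r.
rewrite iterS IH => [|k kn]; last by apply: Dx; exact: ltnW.
rewrite extension_shift; last by apply: (domain_01 HF0); exact: Dx.
by rewrite step_sumSr addrCA addrA.
Qed.

(** [F0] maps each cell into (0, 1), so fractional parts of the lifted orbit recover the base orbit.
    The converse needs strong induction: the iteration formula requires all earlier points in
    [D]. *)
Lemma repeller_extension x (h : int) : D x -> repeller FZ DZ (x + h%:~R) <-> rep x.
Proof.
move=> Dx; split=> [rZ n _ /=|rx n _ /=]; last first.
  rewrite iter_extension => [|k _]; last exact: rx.
  by exists (iter n F0 x); [exact: rx|exists (step_sum F0 psi n x + h)].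
have [m] := ubnP n; elim: m n => // m IH [|n] nm //.
have Dk k : (k < n.+1)%N -> D (iter k F0 x) by move=> kn; apply: IH; lia.
have := rZ n.+1 Logic.I; rewrite /= -iterS iter_extension// => -[y Dy [k _ yE]].
have [|Fy _] := shift_inj (domain_01 HF0 Dy) _ yE; last by rewrite Fy in Dy.
by rewrite iterS; have [i Ii Ji] := Dk n (ltnSn n); exact: (cell_image HF0 Ii Ji).
Qed.

(** Returning to [x + h] means that the fractional part returns to [x] and the integer steps cancel;
    translation by [h] is therefore a bijection from the level-0 periodic points. *)
Lemma extension_pressureE i (h : int) : I i ->
  extension_pressure I J F0 psi i h g = level_pressure [set 0] i g.
Proof.
move=> Ii; rewrite /extension_pressure /pressure /level_pressure; congr (limn_esup _).
apply/funext => n; congr (_ * lne _)%E.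
rewrite (@reindex_esum _ _ _ (level_points [set 0] i n) _ (fun x => x + h%:~R)).
  apply: eq_esum => x [[[rx _] _] _]; congr (expR _)%:E.
  apply: eq_bigr => k _; rewrite /= iter_extension => [|l _]; last exact: rx.
  by rewrite frac_part_shift//; apply: (domain_01 HF0); exact: rx.
split.
- move=> x [[[rx xx] Jx] sx] /=; split; last by exists x.
  split; first by apply/repeller_extension => //; exists i.
  by rewrite iter_extension ?xx ?sx ?add0r// => k _; exact: rx.
- by move=> x y _ _; exact: addIr.
- move=> y [[rZ xZ] [x Jx xy]]; subst y; exists x => //.
  have Dx : D x by exists i.
  have rx : rep x := (repeller_extension h Dx).1 rZ.
  move: xZ; rewrite iter_extension => [xZ|k _]; last exact: rx.
  have [||xx sx] := shift_inj _ _ xZ; try by apply: (domain_01 HF0) => //; exact: rx.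
  by split; [split|rewrite /=; lia].
Qed.

End LevelPressure.

Theorem mainTheorem5 (R : realType) (I : set nat) (J : nat -> set R)
    (F0 : R -> R) (psi : R -> int) (g : R -> R)
    (HF0 : base_map I J F0)
    (Hpsi : step_length I J psi)
    (Htrans : topologically_transitive (extension F0 psi)
                (extension_domain I J))
    (Hg : holder I J F0 g)
    (i j : nat) (h : int) (Ii : I i) (Ij : I j) :
  extension_pressure I J F0 psi i h g =
  ereal_inf [set base_pressure I J F0 j (fun x => g x + q * (psi x)%:~R)
              | q in [set: R]].
Proof.
have [s [K [sa sK]]] := exists_superadditive_weight HF0 Hg.
have g0 : g = tilted psi g 0 by apply/funext => x; rewrite /tilted mul0r addr0.
have s0 : tilt s (cell_step J psi) 0 = s.
  by apply/funext => w; rewrite /tilt mul0r addr0.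
rewrite (extension_pressureE psi g HF0 h Ii).
apply/eqP; rewrite eq_le; apply/andP; split.
  (* A rate above the base pressure in cell [j] bounds all word families, a statement free of the
     cell. On families at level 0 the tilt by [q] vanishes, which gives the bound in cell [i]. *)
  apply/ereal_infP => _ [q _ <-]; rewrite (base_pressureE _ _ _ psi).
  apply: le_of_lt_EFin => c Pc.
  have HW := lt_level_pressure HF0 Hpsi sa sK Ij Logic.I (fun _ _ _ _ => Logic.I) Pc.
  rewrite {1}g0; apply: (level_pressure_le HF0 Hpsi sK) => n W n0 fW W0.
  apply: le_trans (HW n W n0 fW _) => //; rewrite s0 /word_sum.
  rewrite big_seq [leRHS]big_seq; apply: ler_sum => w /W0 /= w0.
  by rewrite /tilt w0 mulr0 addr0.
(* A rate above the extension pressure bounds the level-0 families; the slope [q] extends this bound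
   to all families. *)
apply: le_of_lt_EFin => c; rewrite {1}g0 => Pc.
have [q qP] : exists q : R, forall n W, (0 < n)%N -> word_family I n W ->
    word_sum (tilt s (cell_step J psi) q) W <= expR (c * n%:R).
  apply: (exists_slope sa).
  - exact: (exists_up_cell Hpsi).
  - by have [d Id pd] := exists_down_cell Hpsi; exists d => //; rewrite pd.
  - have := lt_level_pressure HF0 Hpsi sa sK Ii erefl _ Pc; rewrite s0; apply.
    by move=> _ _ -> ->.
apply: (@le_trans _ _ (base_pressure I J F0 j (fun x => g x + q * (psi x)%:~R))).
  by apply: ereal_inf_lbound; exists q.
rewrite (base_pressureE _ _ _ psi).
by apply: (level_pressure_le HF0 Hpsi sK) => n W n0 fW _; exact: qP.
Qed.
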